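(* Let $M$ be a matroid on ground set $[n]=\{1,\dots,n\}$ (with its usual total order). The matroid (base) polytope $P(M)\subseteq\mathbb{R}^n$ is an MV polytope if and only if $M$ is a lattice path matroid.
   Context: Write $e_1,\dots,e_n$ for the standard basis of $\mathbb{R}^n$ and $e_S=\sum_{i\in S}e_i$. The matroid polytope of a matroid $M$ on $[n]$ with set of bases $\mathcal{B}(M)$ is $P(M)=\operatorname{conv}(e_B : B\in\mathcal{B}(M))\subseteq\mathbb{R}^n$. A generalized permutahedron on $[n]$ is a polytope $P\subseteq\mathbb{R}^n$ such that every edge of $P$ is parallel to a vector $e_i-e_j$ with $i\neq j$ (points are allowed). It is a lattice generalized permutahedron if all its vertices lie in $\mathbb{Z}^n$. Its supermodular function is $\mu^P(S)=\min_{x\in P}\sum_{i\in S}x_i$ for $S\subseteq[n]$. A lattice generalized permutahedron $P$ is a Mirković–Vilonen (MV) polytope on $[n]$ if for all $S\subseteq[n]$ and all $a<b<c$ in $[n]\setminus S$, $$\mu^P(S\cup\{b\})+\mu^P(S\cup\{a,c\})=\min\bigl(\mu^P(S\cup\{a\})+\mu^P(S\cup\{b,c\}),\ \mu^P(S\cup\{a,b\})+\mu^P(S\cup\{c\})\bigr).$$ The Gale order on $k$-element subsets of $[n]$: for $A=\{a_1<\dots<a_k\}$ and $B=\{b_1<\dots<b_k\}$, $A\le B$ iff $a_i\le b_i$ for all $i$. For $k$-subsets $S\le T$, the lattice path matroid $M[S,T]$ is the matroid on $[n]$ whose bases are the sets in the Gale interval $[S,T]=\{R\in\binom{[n]}{k}: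 S\le R\le T\}$. A matroid on $[n]$ is a lattice path matroid if it equals $M[S,T]$ for some such $S\le T$ (with respect to the fixed usual order on $[n]$). *)

(* Defs.v *)
(* The ground set [n] is 'I_n with the order of nat, and R^n is 'rV[R]_n. *)
From HB Require Import structures.
From mathcomp Require Import all_boot all_order all_algebra.
From mathcomp Require Import boolp classical_sets reals convex.
Set Implicit Arguments.
Unset Strict Implicit.
Unset Printing Implicit Defensive.
Import Order.TTheory GRing.Theory Num.Theory.
Local Open Scope classical_set_scope.
Local Open Scope ring_scope.

Record matroid (n : nat) := Matroid {
  bases : {set {set 'I_n}};
  bases_neq0 : bases != finset.set0;
  bases_exchange : forall A B : {set 'I_n}, A \in bases -> B \in bases ->
    forall x, x \in A :\: B ->
    exists2 y, y \in B :\: A & y |: (A :\ x) \in bases }.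

(* [enum A] lists the elements of [A] in increasing order, and [all2] is false
   on lists of different sizes: [gale_le] relates only sets of the same size. *)
Definition gale_le (n : nat) (A B : {set 'I_n}) : bool :=
  all2 (fun a b : 'I_n => (a <= b)%N) (enum A) (enum B).

Definition gale_interval (n : nat) (S T : {set 'I_n}) : {set {set 'I_n}} :=
  finset (fun B : {set 'I_n} => gale_le S B && gale_le B T).

Definition lattice_path_matroid (n : nat) (M : matroid n) : Prop :=
  exists S T : {set 'I_n}, gale_le S T /\ bases M = gale_interval S T.

Definition conv_hull (R : realType) (n : nat) (A : set 'rV[R]_n) :
    set 'rV[R]_n :=
  smallest (@convex_set R 'rV[R]_n) A.

(* Polytopes are nonempty by convention, so that [mu] below is a minimum. *)
Definition polytope (R : realType) (n : nat) (P : set 'rV[R]_n) : Prop :=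
  exists2 s : seq 'rV[R]_n, s != [::] & P = conv_hull [set` s].

Definition face (R : realType) (n : nat) (P F : set 'rV[R]_n) : Prop :=
  exists c : 'rV[R]_n, F = [set x | P x /\
    forall y, P y -> \sum_i c 0 i * x 0 i <= \sum_i c 0 i * y 0 i].

Definition vertex (R : realType) (n : nat) (P : set 'rV[R]_n)
    (v : 'rV[R]_n) : Prop :=
  face P [set v].

(* A one-dimensional face of a polytope is a segment [u, v] with [u != v]. *)
Definition edge (R : realType) (n : nat) (P : set 'rV[R]_n)
    (u v : 'rV[R]_n) : Prop :=
  u != v /\ face P (conv_hull [set u; v]).

Definition evec (R : realType) (n : nat) (S : {set 'I_n}) : 'rV[R]_n :=
  \sum_(i in S) delta_mx 0 i.

Definition generalized_permutahedron (R : realType) (n : nat)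
    (P : set 'rV[R]_n) : Prop :=
  polytope P /\
  forall u v, edge P u v ->
    exists i j : 'I_n, i != j /\
      exists t : R, u - v = t *: (delta_mx 0 i - delta_mx 0 j).

Definition lattice_generalized_permutahedron (R : realType) (n : nat)
    (P : set 'rV[R]_n) : Prop :=
  generalized_permutahedron P /\
  forall v, vertex P v -> forall i, v 0 i \is a Num.int.

(* The minimum of a set of reals; the default 0 is returned if there is none,
   which does not happen in [mu P S] for [P] a polytope. *)
Definition minimum (R : realType) (A : set R) : R :=
  xget 0 (A `&` lbound A).

Definition mu (R : realType) (n : nat) (P : set 'rV[R]_n)
    (S : {set 'I_n}) : R :=
  minimum [set \sum_(i in S) x 0 i | x in P].

Definition MV_polytope (R : realType) (n : nat) (P : set 'rV[R]_n) : Prop :=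
  lattice_generalized_permutahedron P /\
  forall (S : {set 'I_n}) (a b c : 'I_n),
    a \notin S -> b \notin S -> c \notin S -> (a < b < c)%N ->
    mu P (S :|: [set b])%SET + mu P (S :|: [set a; c])%SET =
    Num.min (mu P (S :|: [set a])%SET + mu P (S :|: [set b; c])%SET)
            (mu P (S :|: [set a; b])%SET + mu P (S :|: [set c])%SET).

Definition matroid_polytope (R : realType) (n : nat) (M : matroid n) :
    set 'rV[R]_n :=
  conv_hull [set evec R B | B in [set` bases M]].
Arguments matroid_polytope R {n} M.

(* Main.v *)
(* Put [r] for the rank function of [M] and [k] for its rank. Since
   [mu S = k - r (~: S)], the MV equation at [S, a < b < c] concerns the
   three-element minor on [a, b, c] obtained by contracting
   [X := ~: (S :|: [set a; b; c])], and it says exactly that if [a] and [c] are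
   parallel in this minor then so is [b].

   For a lattice path matroid, replacing [a] by [b], or [b] by [c], stays between
   two bases in the Gale order, so this convexity of parallelism holds.

   Conversely let [R] of size [k] satisfy the rank bounds on all initial and final
   segments (i.e. [R] is in the Gale interval between the extreme bases), and
   suppose that it contains a circuit. By convexity, the circuit spans the interval
   [I] between its extremities, so [r I < #|R :&: I|] and no element of the circuit
   is a coloop of [I]. Adding the bounds for the initial and final segments that
   overlap in [I] shows that these two are not a modular pair, so that some [x]
   before [I] and [y] after [I] become parallel in a contraction of some [X]
   containing [I]. Restoring an element of the circuit, which is then a loop between
   [x] and [y], contradicts convexity. *)
Require Import Defs.
From mathcomp Require Import all_boot all_order all_algebra.
From mathcomp Require Import reals zify.
Set Implicit Arguments.
Unset Strict Implicit.
Unset Printing Implicit Defensive.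

Ltac mem_tauto :=
  repeat match goal with
  | |- context [?x == ?y] => destruct (x == y)
  | |- context [?x \in ?Y] => destruct (x \in Y)
  end; done.

Ltac set_tauto := apply/subsetP => ?; rewrite !inE; mem_tauto.

Ltac unpack := repeat match goal with
  | |- prod _ _ -> _ => case
  | |- _ -> _ => let H := fresh in intro H
  end.

(** * Counting in intersections *)

Section SetCard.
Variable E : finType.
Implicit Types (A X : {set E}) (x y : E).

Lemma card_setI_sum A X : #|A :&: X| = \sum_(i in A) (i \in X).
Proof.
rewrite -sum1_card big_mkcond [RHS]big_mkcond; apply: eq_bigr => i _.
by rewrite inE; case: (i \in A); case: (i \in X).
Qed.

Lemma card_setI_exchange A X x y : x \in A -> y \notin A ->
  #|(y |: A :\ x) :&: X| + (x \in X) = #|A :&: X| + (y \in X).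
Proof.
move=> xA yA; rewrite !card_setI_sum big_setU1 /=; last by rewrite !inE negb_and yA orbT.
by rewrite [in RHS](big_setD1 x) //= addnC addnCA addnC.
Qed.

Lemma card_exchange A x y : x \in A -> y \notin A -> #|y |: A :\ x| = #|A|.
Proof.
by move=> xA yA; have := card_setI_exchange setT xA yA; rewrite !setIT !inE; lia.
Qed.

Lemma card_setIU1 A X x : x \notin X ->
  #|A :&: (x |: X)| = (x \in A) + #|A :&: X|.
Proof.
move=> xX; rewrite setIC card_setI_sum big_setU1 //= -card_setI_sum.
by rewrite setIC.
Qed.

End SetCard.

(** * The rank function of a family of bases *)

Section Rank.
Variables (E : finType) (bs : {set {set E}}).
Implicit Types (A B R X Y : {set E}) (x y : E).
Hypothesis bs_exchange : forall A B, A \in bs -> B \in bs ->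
  forall x, x \in A :\: B -> exists2 y, y \in B :\: A & y |: (A :\ x) \in bs.

(** An exchange keeps the size of [A] and brings it closer to [B], so a base larger than [B] would
    give an endless descent on [#|A :\: B|]. *)
Lemma card_bases A B : A \in bs -> B \in bs -> #|A| = #|B|.
Proof.
move=> MA MB; have Hle : forall A B, A \in bs -> B \in bs -> #|A| <= #|B|.
  move=> {}A {}B {}MA {}MB; rewrite leqNgt; apply/negP.
  have [m] := ubnP (#|A :\: B|); elim: m A MA => // m IH A MA ltm ltAB.
  have /subsetPn[x xA xB] : ~~ (A \subset B).
    by apply/negP => /subset_leq_card; lia.
  have [|y] := bs_exchange MA MB (x := x); first by rewrite inE xB.
  rewrite inE => /andP[yA yB] MA'; apply: IH MA' _ _; last by rewrite card_exchange.
  have := card_setI_exchange (~: B) xA yA.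
  by rewrite -!setDE !inE xB yB /=; lia.
by apply/eqP; rewrite eqn_leq !Hle.
Qed.

Hypothesis bs_neq0 : bs != set0.

Definition rk X : nat := \max_(B in bs) #|B :&: X|.

Lemma rk_max B X : B \in bs -> #|B :&: X| <= rk X.
Proof. by move=> MB; apply: (bigmax_sup B). Qed.

Lemma rk_attained X : exists2 B, B \in bs & rk X = #|B :&: X|.
Proof.
have [|B MB rB] := @eq_bigmax_cond _ (mem bs) (fun B => #|B :&: X|).
  by rewrite card_gt0 bs_neq0.
by exists B => //; exact: rB.
Qed.

(* A base of minimum [f]-weight meets every sublevel set of [f] in as many
   elements as possible. *)
Lemma greedy_base (f : E -> nat) : exists2 B, B \in bs &
  forall j, rk [set i | f i < j] = #|B :&: [set i | f i < j]|.
Proof.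
have [B0 MB0] : exists B, B \in bs by apply/set0Pn/bs_neq0.
have [B MB Bmin] := arg_minnP (fun B => \sum_(i in B) f i) MB0.
exists B => // j; apply/eqP; rewrite eqn_leq rk_max // andbT.
set L := finset _; have inL i : (i \in L) = (f i < j) by rewrite inE.
move: L inL => L inL.
apply/bigmax_leqP => B' MB'; rewrite leqNgt; apply/negP.
(* If [B'] meets [L] more than [B] does, exchange its elements outside [L] and [B] for elements of
   [B]. This never shrinks [B' :&: L], and it ends with [B' :\: B] inside [L]. *)
have [m] := ubnP (#|B' :\: B|); elim: m B' MB' => // m IH B' MB' ltm ltL.
have [sL|/subsetPn[x]] := boolP (B' :\: B \subset L); last first.
  rewrite inE => /andP[xB xB'] xL.
  have [|y] := bs_exchange MB' MB (x := x); first by rewrite inE xB.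
  rewrite inE => /andP[yB' yB] MB''; apply: IH MB'' _ _.
    have := card_setI_exchange (~: B) xB' yB'.
    by rewrite -!setDE !inE xB yB /=; move: ltm; clear; lia.
  by have := card_setI_exchange L xB' yB'; rewrite (negPf xL); move: ltL; clear; lia.
(* Equal sizes now give [x] in [B] but neither in [L] nor in [B']. Its replacement [y] lies in [L],
   so [f y < f x], against the minimal weight of [B]. *)
have /subsetPn[x] : ~~ (B :\: L \subset B' :\: L).
  apply/negP => /subset_leq_card.
  by have := card_bases MB MB'; rewrite -(cardsID L B) -(cardsID L B'); lia.
rewrite !inE => /andP[xL xB]; rewrite xL /= => xB'.
have [|y] := bs_exchange MB MB' (x := x); first by rewrite inE xB'.
rewrite inE => /andP[yB yB'] /Bmin.
have : y \in L by apply: (subsetP sL); rewrite inE yB.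
rewrite !inL in xL * => yL.
rewrite big_setU1 /=; last by rewrite !inE negb_and yB orbT.
by rewrite (big_setD1 x xB) /=; move: xL yL; clear; lia.
Qed.

(** The weight is 0 on [X], 1 on [Y :\: X] and 2 elsewhere, which makes [X] and [Y] sublevel sets
    for the greedy base. *)
Lemma rk_attained2 X Y : X \subset Y -> exists2 B, B \in bs &
  rk X = #|B :&: X| /\ rk Y = #|B :&: Y|.
Proof.
move=> sXY; have [B MB HB] := greedy_base (fun i => (i \notin X) + (i \notin Y)).
exists B => //; split.
  suff -> : X = [set i | (i \notin X) + (i \notin Y) < 1] by exact: HB.
  apply/setP => i; rewrite inE; have := subsetP sXY i.
  by case: (i \in X); case: (i \in Y) => // ->.
suff -> : Y = [set i | (i \notin X) + (i \notin Y) < 2] by exact: HB.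
apply/setP => i; rewrite inE; have := subsetP sXY i.
by case: (i \in X); case: (i \in Y) => // ->.
Qed.

(** A single base attains the ranks of the intersection and of the union, and cardinality is
    modular. *)
Lemma rk_submod X Y : rk (X :|: Y) + rk (X :&: Y) <= rk X + rk Y.
Proof.
have [|B MB [-> ->]] := @rk_attained2 (X :&: Y) (X :|: Y).
  by apply/subsetP => i; rewrite !inE => /andP[->].
have -> : #|B :&: (X :|: Y)| + #|B :&: (X :&: Y)| = #|B :&: X| + #|B :&: Y|.
  by rewrite setIUr setIIr cardsUI.
by rewrite leq_add ?rk_max.
Qed.

Lemma rkS X Y : X \subset Y -> rk X <= rk Y.
Proof.
move=> sXY; have [B MB ->] := rk_attained X.
by apply: leq_trans (rk_max Y MB); apply/subset_leq_card/setIS.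
Qed.

Lemma rk_le_card X : rk X <= #|X|.
Proof.
by have [B MB ->] := rk_attained X; apply/subset_leq_card/subsetIr.
Qed.

Lemma rk_leqU X Y : rk (X :|: Y) <= rk X + #|Y|.
Proof. by have := rk_submod X Y; have := rk_le_card Y; lia. Qed.

Lemma rkU1 x X : rk (x |: X) <= (rk X).+1.
Proof. by have := rk_leqU X [set x]; rewrite setUC cards1 addn1. Qed.

(** In a base attaining both ranks, an element of [Y] outside [X] would make [rk (y |: X)] exceed
    [rk X]. *)
Lemma rk_closure X Y : (forall y, y \in Y -> rk (y |: X) = rk X) ->
  rk (X :|: Y) = rk X.
Proof.
move=> clY; apply/eqP; rewrite eqn_leq [X in _ && X]rkS ?subsetUl // andbT.
have [B MB [rX rXY]] := rk_attained2 (subsetUl X Y).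
rewrite rX rXY; apply/subset_leq_card/subsetP => y.
rewrite !inE => /andP[yB /orP[yX|yY]]; first by rewrite yB.
rewrite yB; apply/negPn/negP => /= yX.
have := rk_max (y |: X) MB; rewrite clY // rX setIUr.
have -> : B :&: [set y] = [set y] by apply/setIidPr; rewrite sub1set.
by rewrite cardsU1 !inE (negPf yX) andbF; lia.
Qed.

Lemma rk_base B X : B \in bs -> B \subset X -> rk X = #|B|.
Proof.
move=> MB sBX; apply/eqP; rewrite eqn_leq -{2}(setIidPl sBX) rk_max // andbT.
by have [B' MB' ->] := rk_attained X;
   rewrite (card_bases MB MB') subset_leq_card ?subsetIl.
Qed.

Lemma base_of_rk B X : B \in bs -> #|X| = #|B| -> rk X = #|B| ->
  X \in bs.
Proof.
move=> MB cX rX; have [B' MB' rX'] := rk_attained X.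
suff <- : B' = X by [].
have /eqP BX : B' :&: X == X by rewrite eqEcard subsetIr; lia.
apply/esym/eqP; rewrite eqEcard cX (card_bases MB MB') leqnn andbT.
by rewrite -BX subsetIl.
Qed.

Lemma rk_submodS (U Z X Y : {set E}) : U \subset X :|: Y -> Z \subset X :&: Y ->
  rk U + rk Z <= rk X + rk Y.
Proof.
by move=> /rkS sU /rkS sZ; apply: leq_trans (leq_add sU sZ) (rk_submod X Y).
Qed.

(** * The MV condition and convexity of parallelism *)

Variable pos : E -> nat.

Definition MV_rank := forall X a b c, a \notin X -> b \notin X -> c \notin X ->
  pos a < pos b < pos c ->
  rk (b |: X) + rk (a |: (c |: X)) =
  maxn (rk (a |: X) + rk (b |: (c |: X))) (rk (c |: X) + rk (a |: (b |: X))).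

(* Whenever [a] and [c] are parallel in the contraction of [X], so is every
   element between them. *)
Definition parallel_convex := forall X a b c,
  a \notin X -> b \notin X -> c \notin X -> pos a < pos b < pos c ->
  rk (a |: X) = (rk X).+1 -> rk (c |: X) = (rk X).+1 ->
  rk (a |: (c |: X)) = (rk X).+1 ->
  rk (b |: X) = (rk X).+1 /\ rk (a |: (b |: (c |: X))) = (rk X).+1.

(** The equivalence holds separately at each [X], [a], [b], [c]: unit increments and submodularity
    leave finitely many rank patterns for a three-element minor, and linear arithmetic checks
    them. *)
Lemma MV_rankP : MV_rank <-> parallel_convex.
Proof.
suff eqv X a b c :
    rk (b |: X) + rk (a |: (c |: X)) =
    maxn (rk (a |: X) + rk (b |: (c |: X))) (rk (c |: X) + rk (a |: (b |: X))) <->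
    (rk (a |: X) = (rk X).+1 -> rk (c |: X) = (rk X).+1 ->
     rk (a |: (c |: X)) = (rk X).+1 ->
     rk (b |: X) = (rk X).+1 /\ rk (a |: (b |: (c |: X))) = (rk X).+1).
  by split=> H X a b c aX bX cX abc; apply/eqv; apply: H.
have inc x Y : rk Y <= rk (x |: Y) <= (rk Y).+1 by rewrite rkU1 rkS ?subsetUr.
have sub2 x y Y : rk (x |: (y |: Y)) + rk Y <= rk (x |: Y) + rk (y |: Y).
  by apply: rk_submodS; set_tauto.
have sub3 x y z Y : rk (x |: (y |: (z |: Y))) + rk (y |: Y) <=
    rk (x |: (y |: Y)) + rk (y |: (z |: Y)).
  by apply: rk_submodS; set_tauto.
have := (inc a X, inc b X, inc c X, inc a (c |: X), inc a (b |: (c |: X))).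
have := (sub2 a b X, sub2 a c X, sub2 b c X, sub3 a b c X).
have := (inc c (a |: X), inc b (a |: (c |: X)), inc c (a |: (b |: X))).
have := (inc b (a |: X), inc a (b |: X), inc b (c |: X), inc c (b |: X)).
rewrite (setUCA [set b] [set a] (c |: X)) (setUCA [set c] [set a] (b |: X)).
rewrite (setUCA [set c] [set b] X) (setUCA [set c] [set a] X) (setUCA [set b] [set a] X).
clear; unpack; split; first by lia.
case: (boolP [&& rk (a |: X) == (rk X).+1, rk (c |: X) == (rk X).+1 &
              rk (a |: (c |: X)) == (rk X).+1]) => [/and3P[/eqP ea /eqP ec /eqP eac]|].
  by move=> /(_ ea ec eac)[eb eabc]; lia.
by move=> + _; lia.
Qed.

(** Convexity of the bases for the Gale order, [A] being the lower end and [B] the upper one. *)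
Definition count_convex := forall A B Y, A \in bs -> B \in bs -> #|Y| = #|A| ->
  (forall j, #|B :&: [set i | pos i < j]| <= #|Y :&: [set i | pos i < j]|
             <= #|A :&: [set i | pos i < j]|) -> Y \in bs.

(** Take a base [B] through [a] such that replacing [a] by [c] gives a base [B']. If [b] were a loop
    or a coloop of the minor, a set between [B] and [B'] would be a base meeting some set in more
    elements than its rank. *)
Lemma count_convex_parallel : count_convex -> parallel_convex.
Proof.
move=> conv X a b c aX bX cX /andP[ab bc] ra rc rac.
have neab : a != b by apply: contraTneq ab => ->; rewrite ltnn.
have nebc : b != c by apply: contraTneq bc => ->; rewrite ltnn.
have neac : a != c by apply: contraTneq (ltn_trans ab bc) => ->; rewrite ltnn.
have acX : a \notin c |: X by rewrite !inE (negPf neac).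
have caX : c \notin a |: X by rewrite !inE eq_sym (negPf neac).
have bacX : b \notin a |: (c |: X).
  by rewrite !inE eq_sym (negPf neab) (negPf nebc).
have [|B MB [rBa rBabc]] := rk_attained2 (X := a |: X) (Y := b |: (a |: (c |: X))).
  by set_tauto.
have := rk_max X MB; have := rk_max (a |: (c |: X)) MB.
rewrite setUCA card_setIU1 // -rBa -setUCA rac ra.
move: rBa; rewrite card_setIU1 // ra => rBa cB' sB.
have [aB rBX] : a \in B /\ #|B :&: X| = rk X.
  by move: rBa sB; clear; case: (a \in B) => //=; split=> //; lia.
have cB : c \notin B by move: cB'; case: (c \in B) => //; rewrite ltnn.
(* Submodularity is used twice: [c] is independent of [B :&: X], and [a] is in the span of [c |: X],
   so trading [a] for [c] loses no rank. *)
have MB' : c |: B :\ a \in bs.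
  apply: (base_of_rk MB); first exact: card_exchange.
  apply/eqP; rewrite eqn_leq -{1}(card_exchange aB cB) rk_le_card /=.
  have : rk (c |: X) + rk (B :&: X) <= rk (c |: (B :&: X)) + rk X.
    by apply: rk_submodS; set_tauto.
  have : rk B + rk (c |: (B :&: X)) <= rk (c |: B :\ a) + rk (a |: (c |: X)).
    apply: rk_submodS; first by set_tauto.
    apply/subsetP => i; rewrite !inE; case: (eqVneq i a) => [->|_].
      by rewrite (negPf aX) (negPf neac) andbF.
    mem_tauto.
  have := rk_max B MB; rewrite setIid.
  have := rk_max (B :&: X) MB; rewrite setIA setIid rBX rac rc.
  by clear; lia.
(* Otherwise [b] is a loop in the contraction of [X]. *)
have rb : rk (b |: X) = (rk X).+1.
  apply/eqP; rewrite eqn_leq rkU1 ltnNge; apply/negP => lerb.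
  have bB : b \notin B.
    apply: contraTN lerb => bB; rewrite -ltnNge.
    by apply: leq_trans (rk_max (b |: X) MB); rewrite card_setIU1 // bB rBX.
  have MY : b |: B :\ a \in bs.
    apply: (conv _ _ _ MB MB'); first exact: card_exchange.
    move=> j; set L := finset _.
    have := card_setI_exchange L aB bB; have := card_setI_exchange L aB cB.
    by rewrite !inE; move: ab bc; clear; lia.
  have := rk_max (b |: X) MY; have := card_setI_exchange (b |: X) aB bB.
  rewrite !inE (negPf neab) (negPf aX) eqxx (card_setIU1 B bX) (negPf bB) rBX.
  by move: lerb; clear; lia.
split=> //; apply/eqP; rewrite eqn_leq; apply/andP; split; last first.
  by rewrite -rac; apply: rkS => //; set_tauto.
(* Otherwise [b] is a coloop once [X] is contracted. *)
rewrite leqNgt; apply/negP => rabc.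
have bB : b \in B.
  move: rabc; rewrite setUCA rBabc (card_setIU1 B bacX) (card_setIU1 B acX).
  rewrite (card_setIU1 B cX) aB (negPf cB) rBX.
  by clear; case: (b \in B) => //; lia.
have MY : c |: B :\ b \in bs.
  apply: (conv _ _ _ MB MB'); first exact: card_exchange.
  move=> j; set L := finset _.
  have := card_setI_exchange L bB cB; have := card_setI_exchange L aB cB.
  by rewrite !inE; move: ab bc; clear; lia.
(* This base contains [a], [c] and [rk X] elements of [X], although [a] and [c] are parallel. *)
have := rk_max (a |: (c |: X)) MY; have := card_setI_exchange (a |: (c |: X)) bB cB.
rewrite (negPf bacX) rac (setUCA [set a]) !inE eqxx /=.
rewrite (card_setIU1 B caX) (negPf cB) (card_setIU1 B aX) aB rBX.
by clear; lia.
Qed.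

(** * From bounds on segments to bases *)

Hypothesis pos_inj : injective pos.

(* The interval is the convex hull of a circuit [C] contained in [R]: by
   [parallel_convex], [C] spans it. *)
Lemma dependent_interval R : parallel_convex -> rk R < #|R| ->
  exists a c, pos a <= pos c /\
  let I := [set i | pos a <= pos i <= pos c] in
  rk I < #|R :&: I| /\ rk (I :\ a) = rk I.
Proof.
move=> pc depR; have [C /minsetP[depC Cmin] sCR] :=
  minset_exists (P := fun C : {set E} => rk C < #|C|) depR.
have indep (D : {set E}) : D \proper C -> rk D = #|D|.
  move=> /[dup] /proper_sub sDC /proper_neq neDC.
  apply/eqP; rewrite eqn_leq rk_le_card leqNgt; apply/negP => /Cmin/(_ sDC)/eqP.
  exact/negP.
have [x0 x0C] : exists x, x \in C.
  by apply/set0Pn; rewrite -card_gt0; apply: leq_trans depC.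
have [a aC amin] : exists2 a, a \in C & forall i, i \in C -> pos a <= pos i.
  by have [a aC amin] := arg_minnP pos x0C; exists a.
have [c cC cmax] : exists2 c, c \in C & forall i, i \in C -> pos i <= pos c.
  by have [c cC cmax] := arg_maxnP pos x0C; exists c.
have rkD x : x \in C -> (rk (C :\ x)).+1 = #|C| /\ rk (C :\ x) = rk C.
  move=> xC; have := indep _ (properD1 xC); have := cardsD1 x C; rewrite xC.
  by have := rkS (subD1set C x); lia.
exists a, c; split; first exact: amin.
move=> I.
have sCI : C \subset I by apply/subsetP => i iC; rewrite inE amin //=; apply: cmax.
have clI b : b \in I -> rk (b |: C) = rk C.
  rewrite inE => /andP[ab bc]; have [bC|bC] := boolP (b \in C).
    by rewrite (setUidPr _) // sub1set.
  have ltab : pos a < pos b.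
    rewrite ltn_neqAle ab andbT; apply/eqP => /pos_inj eab.
    by rewrite -eab aC in bC.
  have ltbc : pos b < pos c.
    rewrite ltn_neqAle bc andbT; apply/eqP => /pos_inj ebc.
    by rewrite ebc cC in bC.
  have neac : c != a by apply/eqP => eac; move: ltab ltbc; rewrite eac; clear; lia.
  have eX : C :\ a :\ c = C :\ c :\ a by rewrite setDDl setUC -setDDl.
  have ec : c |: (C :\ a :\ c) = C :\ a by rewrite setD1K // !inE neac.
  have ea : a |: (C :\ a :\ c) = C :\ c.
    by rewrite eX setD1K // !inE eq_sym neac.
  have rX : (rk (C :\ a :\ c)).+1 = rk C.
    have := cardsD1 a C; have := cardsD1 c (C :\ a); have := rkD a aC.
    rewrite !inE neac cC aC (indep (C :\ a :\ c)); first by clear; lia.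
    by apply: sub_proper_trans (properD1 aC); apply: subD1set.
  (* Contracting the rest of the circuit makes its extremities [a] and [c] parallel, so [b], lying
     between them, is in the span of [C]. *)
  have [] := pc (C :\ a :\ c) a b c.
  - by rewrite !inE eqxx andbF.
  - by rewrite !inE (negPf bC) !andbF.
  - by rewrite !inE eqxx.
  - by rewrite ltab.
  - by rewrite ea rX; case: (rkD c cC).
  - by rewrite ec rX; case: (rkD a aC).
  - by rewrite ec setD1K // rX.
  by move=> _; rewrite ec setUCA setD1K // rX.
have rI : rk I = rk C by rewrite -(rk_closure clI) (setUidPr sCI).
split.
  rewrite rI (leq_trans depC) //; apply/subset_leq_card.
  by rewrite subsetI sCR.
apply/eqP; rewrite eqn_leq rkS ?subD1set // rI -(rkD a aC).2 rkS //.
exact: setSD.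
Qed.

(** Only the independence of [R] is at stake; the bounds are applied at the end points of the
    interval given by [dependent_interval]. *)
Lemma interval_bound_base B0 R : parallel_convex -> B0 \in bs ->
  #|R| = #|B0| ->
  (forall j, #|R :&: [set i | pos i < j]| <= rk [set i | pos i < j]) ->
  (forall j, #|R :&: [set i | j <= pos i]| <= rk [set i | j <= pos i]) ->
  R \in bs.
Proof.
move=> pc MB0 cR Rlow Rup; apply: (base_of_rk MB0) => //.
apply/eqP; rewrite eqn_leq -{1}cR rk_le_card leqNgt -cR; apply/negP.
move=> /(dependent_interval pc)[a [c [ac []]]].
set I := finset _ => ltRI rIa.
(* The successor lets the strict inequality include [c]. *)
pose LI := [set i | pos i < (pos c).+1]; pose IU := [set i | pos a <= pos i].
have aI : a \in I by rewrite inE leqnn.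
have sILI : I \subset LI by apply/subsetP => i; rewrite !inE => /andP[_].
have sIIU : I \subset IU by apply/subsetP => i; rewrite !inE => /andP[].
have cRI : #|R :&: LI| + #|R :&: IU| = #|R| + #|R :&: I|.
  have eU : LI :|: IU = setT by apply/setP => i; rewrite !inE; move: ac; clear; lia.
  have eI : LI :&: IU = I by apply/setP => i; rewrite !inE; move: ac; clear; lia.
  by rewrite -cardsUI -setIUr -setIIr eU eI setIT.
(* Together with [ltRI] this gives [rk I + #|R| < rk LI + rk IU]. *)
have := leq_add (Rlow (pos c).+1) (Rup (pos a)); rewrite -/LI -/IU cRI => le_mod.
have [B MB [rI rLI]] := rk_attained2 sILI.
have cB : #|R| = #|B| by rewrite cR (card_bases MB0 MB).
(* As [rk LI + rk IU] exceeds [rk I + rk setT], [Y] does not span [IU]. *)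
pose Y := I :|: (B :\: LI).
have rY : rk Y + rk LI <= rk I + #|R|.
  by have := rk_leqU I (B :\: LI); rewrite -/Y cB rLI -(cardsID LI B); lia.
have [y yIU rkyY] : exists2 y, y \in IU & rk (y |: Y) = (rk Y).+1.
  have [/existsP[y /andP[yIU ry]]|] :=
    boolP [exists y, (y \in IU) && (rk Y < rk (y |: Y))].
    by exists y => //; apply/eqP; rewrite eqn_leq rkU1.
  move=> /existsPn clY; have : rk (Y :|: IU) = rk Y.
    apply: rk_closure => y yIU; have := clY y; rewrite yIU /= -leqNgt => ry.
    by apply/eqP; rewrite eqn_leq ry rkS ?subsetUr.
  by have := rkS (subsetUr Y IU); lia.
(* Enlarge [Y] inside [I :|: B] as long as [y] stays outside its span. *)
have [X /maxsetP[/andP[sXIB /eqP ryX] Xmax] sYX] := maxset_exists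
  (P := fun X : {set E} => (X \subset I :|: B) && (rk (y |: X) == (rk X).+1)) (C := Y)
  (introT andP (conj (setUS I (subsetDl B LI)) (introT eqP rkyY))).
have yX : y \notin X.
  by apply/negP => yX; move: ryX; rewrite (setUidPr _) ?sub1set // => /n_Sn.
have sIX : I \subset X := subset_trans (subsetUl _ _) sYX.
have cy : pos c < pos y.
  have := contra (subsetP sIX y) yX; by move: yIU; rewrite !inE; clear; lia.
(* The enlargement stops before [I :|: B], which contains a base and hence spans [y]. *)
have /subsetPn[x xIB xX] : ~~ (I :|: B \subset X).
  apply/negP => sIBX; have eX : X = I :|: B by apply/eqP; rewrite eqEsubset sXIB.
  move: ryX; rewrite eX (rk_base MB (subsetUr I B)) (rk_base MB (_ : B \subset _)).
    by clear; lia.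
  by rewrite setUA subsetUr.
have xa : pos x < pos a.
  have xI := contra (subsetP sIX x) xX; have := contra (subsetP sYX x) xX.
  by move: xIB xI; rewrite !inE; case: (x \in B); clear; lia.
(* By maximality, adding [x] to [X] puts [y] in the span. *)
have rxyX : rk (y |: (x |: X)) = rk (x |: X).
  apply/eqP; rewrite eqn_leq (rkS (subsetUr _ _)) andbT leqNgt.
  apply/negP => ltx; have : x |: X = X.
    apply: Xmax; last exact: subsetUr.
    by rewrite subUset sub1set xIB sXIB eqn_leq rkU1.
  by move/setP/(_ x); rewrite !inE eqxx (negPf xX).
have rxX : rk (x |: X) = (rk X).+1.
  apply/eqP; rewrite eqn_leq rkU1 -ryX -rxyX rkS //.
  exact/setUS/subsetUr.
have aX : a \in X := subsetP sIX a aI.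
(* [a] is in the span of [I :\ a], hence in that of [X :\ a]. *)
have rX0 : rk (X :\ a) = rk X.
  apply/eqP; rewrite eqn_leq rkS ?subD1set //.
  have : rk X + rk (I :\ a) <= rk (X :\ a) + rk I; last by rewrite rIa leq_add2r.
  apply: rk_submodS; last by rewrite subsetI setSD // subD1set.
  by rewrite -{1}(setD1K aX) setUC setUS // sub1set.
have rz z : rk (z |: X) = (rk X).+1 -> rk (z |: (X :\ a)) = (rk X).+1.
  move=> rzX; apply/eqP; rewrite eqn_leq -{1}rzX rkS ?setUS ?subD1set //.
  have : rk (z |: X) + rk (X :\ a) <= rk (z |: (X :\ a)) + rk X.
    apply: rk_submodS; first by rewrite -setUA setUS ?subsetUr.
    by rewrite subsetI subsetUr subD1set.
  by rewrite rX0 leq_add2r rzX.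
(* [x] and [y] are parallel and [a] is a loop in the contraction of [X :\ a]. *)
have [] := pc (X :\ a) x a y.
- by rewrite !inE (negPf xX) andbF.
- by rewrite !inE eqxx.
- by rewrite !inE (negPf yX) andbF.
- by rewrite xa (leq_ltn_trans ac cy).
- by rewrite rX0 rz.
- by rewrite rX0 rz.
- apply/eqP; rewrite eqn_leq {2}rX0 -(rz _ ryX) (rkS (subsetUr _ _)) andbT.
  rewrite rX0 -rxX -rxyX setUCA.
  exact/rkS/setUS/setUS/subD1set.
by rewrite setD1K // rX0 => /n_Sn.
Qed.

End Rank.

(** * The Gale order by counting, and lattice path matroids *)

Lemma all2_leq_countP (s t : seq nat) : sorted ltn s -> sorted ltn t ->
  all2 leq s t <->
  size s = size t /\ forall j, count (fun x => x < j) t <= count (fun x => x < j) s.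
Proof.
elim: s t => [|a s IH] [|b t] /=.
- by [].
- by move=> _ _; split=> // -[].
- by move=> _ _; split=> // -[].
rewrite !path_sortedE; try exact: ltn_trans.
move=> /andP[minA sS] /andP[minB sT]; split=> [/andP[ab /(IH _ sS sT)[-> H]]|].
  by split=> // j; have := H j; move: ab; clear; lia.
case=> -[/[dup] /eqP sz sz'] H.
(* If [b < a], the threshold [b.+1] counts [b] on one side and nothing on the other. *)
have ab : a <= b.
  rewrite leqNgt; apply/negP => ba.
  have := H b.+1; rewrite ltnSn [a < _]ltnS [a <= _]leqNgt ba /=.
  suff -> : count (fun x => x < b.+1) s = 0 by [].
  apply/eqP; rewrite -leqn0 leqNgt -has_count -all_predC; apply/allP => x xs /=.
  by rewrite -leqNgt; apply: leq_trans ba (ltnW (allP minA x xs)).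
rewrite ab /=; apply/IH => //; split=> // j; have := H j.
have [bj|jb] := ltnP b j; first by rewrite (leq_ltn_trans ab bj) leq_add2l.
move=> _; suff -> : count (fun x => x < j) t = 0 by [].
apply/eqP; rewrite -leqn0 leqNgt -has_count -all_predC; apply/allP => x xt /=.
by rewrite -leqNgt; apply: leq_trans jb (ltnW (allP minB x xt)).
Qed.

Lemma gale_leP n (A B : {set 'I_n}) : gale_le A B <->
  #|A| = #|B| /\ forall j, #|B :&: [set i : 'I_n | i < j]| <= #|A :&: [set i : 'I_n | i < j]|.
Proof.
have srt (C : {set 'I_n}) : sorted ltn (map val (enum C)).
  have -> : enum C = [seq i <- enum 'I_n | i \in C] by rewrite [enum 'I_n]enumT.
  rewrite sorted_map; apply: sorted_filter => [i j k|]; first exact: ltn_trans.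
  by rewrite -sorted_map val_enum_ord iota_ltn_sorted.
have cnt (C : {set 'I_n}) j :
    count (fun x => x < j) (map val (enum C)) = #|C :&: [set i : 'I_n | i < j]|.
  rewrite count_map cardE (perm_size (enum_setI _ _)) size_filter.
  by apply: eq_count => i; rewrite /= inE.
have -> : gale_le A B = all2 leq (map val (enum A)) (map val (enum B)).
  rewrite /gale_le; elim: (enum A) (enum B) => [|a s IH] [|b t] //=.
  by rewrite IH.
rewrite (all2_leq_countP (srt A) (srt B)) !size_map -!cardE.
by split=> -[-> H]; split=> // j; have := H j; rewrite !cnt.
Qed.

Lemma lattice_path_parallel_convex n (M : matroid n) :
  lattice_path_matroid M <-> parallel_convex (bases M) (@nat_of_ord n).
Proof.
split=> [[S [T [_ MI]]]|pc].
  apply: (count_convex_parallel (@bases_exchange _ M) (bases_neq0 M)).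
  move=> A B Y; rewrite MI !inE => /andP[/gale_leP[cSA SA] /gale_leP[cAT _]].
  move=> /andP[_ /gale_leP[_ BT]] cYA YAB.
  apply/andP; split; apply/gale_leP; split=> [|j]; rewrite ?cYA //.
    by have /andP[_ /leq_trans] := YAB j; apply.
  by have /andP[+ _] := YAB j; apply: leq_trans.
(* The weights [i] and [n - i] select the extreme bases: [S] attains the rank of every initial
   segment, [T] that of every final segment. *)
have [S MS Sg] := greedy_base (@bases_exchange _ M) (bases_neq0 M) (@nat_of_ord n).
have [T MT Tg] := greedy_base (@bases_exchange _ M) (bases_neq0 M) (fun i : 'I_n => n - i).
have eqc := card_bases (@bases_exchange _ M).
(* This survives truncated subtraction: for [j > n] both sets are empty, since [i < n]. *)
have up j : [set i : 'I_n | j <= i] = [set i : 'I_n | n - i < (n - j).+1].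
  by apply/setP => i; rewrite !inE; have := ltn_ord i; clear; lia.
have split_card j (B : {set 'I_n}) :
    #|B :&: [set i : 'I_n | i < j]| + #|B :&: [set i : 'I_n | j <= i]| = #|B|.
  have -> : [set i : 'I_n | j <= i] = ~: [set i : 'I_n | i < j].
    by apply/setP => i; rewrite !inE -leqNgt.
  by rewrite -setDE cardsID.
(* Passing to complements turns comparison with [T] on an initial segment into a rank bound on the
   final one. *)
have TgC j (B : {set 'I_n}) : #|B| = #|T| ->
    (#|T :&: [set i : 'I_n | i < j]| <= #|B :&: [set i : 'I_n | i < j]|) =
    (#|B :&: [set i : 'I_n | j <= i]| <= rk (bases M) [set i : 'I_n | j <= i]).
  have := Tg (n - j).+1; rewrite -up => -> cBT.
  by have := (split_card j B, split_card j T); rewrite cBT => -[<-]; clear; lia.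
have base_S B : B \in bases M -> gale_le S B.
  move=> MB; apply/gale_leP; split=> [|j]; first exact: eqc.
  by rewrite -Sg; apply: rk_max.
have base_T B : B \in bases M -> gale_le B T.
  move=> MB; apply/gale_leP; split=> [|j]; first exact: eqc.
  by rewrite TgC ?rk_max //; apply: eqc.
exists S, T; split; first exact: base_S.
apply/setP => R; rewrite inE; apply/idP/andP => [MR|[]].
  by rewrite base_S ?base_T.
move=> /gale_leP[cSR SR] /gale_leP[cRT RT].
apply: (interval_bound_base (@bases_exchange _ M) (bases_neq0 M) (@ord_inj n) pc MS) => // j.
  by rewrite Sg.
by rewrite -TgC.
Qed.

From mathcomp Require Import boolp classical_sets convex interval_inference ring lra.
Import Order.TTheory GRing.Theory Num.Theory.
Local Open Scope classical_set_scope.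
Local Open Scope ring_scope.

(** * Convex hulls and linear functionals *)

Section ConvexHull.
Variables (R : realType) (n : nat).
Implicit Types (A : set 'rV[R]_n) (c u v x y : 'rV[R]_n).

Lemma convex_setI01 A :
  (forall x y t, 0 <= t <= 1 -> A x -> A y -> A (t *: x + (1 - t) *: y)) ->
  @convex_set R 'rV[R]_n A.
Proof.
move=> cA x y t; rewrite !inE => Ax Ay; apply: cA => //.
by apply/andP; split; [exact: ge0 | exact: le1].
Qed.

Definition dot c x : R := \sum_i c 0 i * x 0 i.

Lemma dot_comb c x y t :
  dot c (t *: x + (1 - t) *: y) = t * dot c x + (1 - t) * dot c y.
Proof.
rewrite /dot !mulr_sumr -big_split; apply: eq_bigr => i _ /=.
by rewrite !mxE; ring.
Qed.

Lemma conv_hull_sub A B : A `<=` B -> @convex_set R 'rV[R]_n B ->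
  conv_hull A `<=` B.
Proof. by move=> sAB cB; apply: smallest_sub. Qed.

Lemma conv_hull_gen A : A `<=` conv_hull A.
Proof. exact: sub_gen_smallest. Qed.

Lemma conv_hull_dot_ge A c m : (forall x, A x -> m <= dot c x) ->
  forall x, conv_hull A x -> m <= dot c x.
Proof.
move=> Am; apply: conv_hull_sub => //; apply: convex_setI01 => x y t t01 mx my.
by rewrite dot_comb; nra.
Qed.

(** An open half-space with the single boundary point [v] added is still convex. *)
Lemma conv_hull_dot_unique A c v : (forall x, A x -> x <> v -> dot c v < dot c x) ->
  forall x, conv_hull A x -> dot c x <= dot c v -> x = v.
Proof.
move=> Av x Ax; have : [set x | dot c v < dot c x \/ x = v] x.
  move: x Ax; apply: conv_hull_sub => [x Ax|].
    by have [->|/eqP ?] := eqVneq x v; [right | left; apply: Av].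
  apply: convex_setI01 => x y t /andP[t0 t1] /=.
  have [->|tn0] := eqVneq t 0; first by rewrite scale0r add0r subr0 scale1r.
  have [->|tn1] := eqVneq t 1; first by rewrite subrr scale0r addr0 scale1r.
  have {}t0 : 0 < t by rewrite lt_neqAle eq_sym tn0.
  have {}t1 : t < 1 by rewrite lt_neqAle tn1.
  move=> [ltx|->] [lty|->] /=; rewrite ?dot_comb; try by left; nra.
  by right; rewrite -scalerDl addrC subrK scale1r.
by move=> [ltx|//]; rewrite leNgt ltx.
Qed.

(** The direction of an edge depends only on its line, so the range of [t] is left out. *)
Lemma conv_hull2_line u v x : conv_hull [set u; v] x -> exists t, x = v + t *: (u - v).
Proof.
move: x; apply: conv_hull_sub => [x [->|->]|].
- by exists 1; rewrite scale1r addrC subrK.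
- by exists 0; rewrite scale0r addr0.
apply: convex_setI01 => x y t _ [s ->] [s' ->]; exists (t * s + (1 - t) * s').
by apply/matrixP => i j; rewrite !mxE; ring.
Qed.

End ConvexHull.

Lemma minimum_eq (R : realType) (A : set R) (m : R) :
  A m -> (forall y, A y -> m <= y) -> minimum A = m.
Proof.
move=> Am mA; rewrite /minimum; case: xgetP => [y _ [Ay yA]|/(_ m)]; last by case.
by apply: le_anti; rewrite mA // yA.
Qed.

(** * Edges and supermodular function of the matroid polytope *)

Section MatroidPolytope.
Variables (R : realType) (n : nat) (M : matroid n).
Implicit Types (A B S : {set 'I_n}) (c u v x y : 'rV[R]_n).
Local Notation P := (matroid_polytope R M).

Lemma evecE S i : evec R S 0 i = (i \in S)%:R.
Proof.
rewrite /evec summxE (eq_bigr (fun j => (i == j)%:R)); last first.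
  by move=> j _; rewrite mxE eqxx.
have [iS|iS] := boolP (i \in S).
  rewrite (bigD1 i) //= eqxx big1 ?addr0 // => j /andP[_ /negPf].
  by rewrite eq_sym => ->.
rewrite big1 // => j jS; case: eqVneq => // ij.
by rewrite ij jS in iS.
Qed.

Lemma dot_evec c B : dot c (evec R B) = \sum_(i in B) c 0 i.
Proof.
rewrite /dot [RHS]big_mkcond; apply: eq_bigr => i _.
by rewrite evecE; case: (i \in B); rewrite ?mulr1 ?mulr0.
Qed.

Lemma dot_evecl S x : dot (evec R S) x = \sum_(i in S) x 0 i.
Proof.
by rewrite -dot_evec; apply: eq_bigr => i _; rewrite mulrC.
Qed.

Lemma evec_exchange A a b : a \in A -> b \notin A ->
  evec R (b |: A :\ a)%SET = evec R A + delta_mx 0 b - delta_mx 0 a.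
Proof.
move=> aA bA; apply/rowP => i; rewrite !mxE !evecE !inE eqxx.
have neab : b != a by apply: contraNneq bA => ->.
case: (eqVneq i b) => [->|_] /=.
  by rewrite (negPf bA) (negPf neab) add0r subr0.
case: (eqVneq i a) => [->|_] /=; first by rewrite aA addr0 subrr.
by rewrite addr0 subr0.
Qed.

Definition minimal c B := B \in bases M /\
  forall B', B' \in bases M -> dot c (evec R B) <= dot c (evec R B').

Lemma minimal_exists c : exists B, minimal c B.
Proof.
have [B0 MB0] : exists B, B \in bases M by apply/finset.set0Pn/bases_neq0.
have [B MB Bmin] := arg_minP (fun B => dot c (evec R B)) MB0.
by exists B.
Qed.

Lemma base_in_polytope B : B \in bases M -> P (evec R B).
Proof. by move=> MB; apply: conv_hull_gen; exists B. Qed.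

Lemma minimal_dot c B x : minimal c B -> P x -> dot c (evec R B) <= dot c x.
Proof.
by case=> MB Bmin; apply: conv_hull_dot_ge => _ [B' MB' <-]; apply: Bmin.
Qed.

(* Exchange an element of maximum cost of the symmetric difference. *)
Lemma minimal_exchange c A B : minimal c A -> minimal c B -> A != B ->
  exists A0 A' i j, [/\ minimal c A0, minimal c A', i != j &
    evec R A' - evec R A0 = delta_mx 0 i - delta_mx 0 j].
Proof.
move=> mA mB neAB.
have [p0 p0AB] : exists p, p \in ((A :\: B) :|: (B :\: A))%SET.
  apply/finset.set0Pn; apply: contraNneq neAB => /eqP.
  rewrite finset.setU_eq0 !finset.setD_eq0 => /andP[sAB sBA].
  by rewrite finset.eqEsubset sAB.
have [p pAB pmax] : exists2 p, p \in ((A :\: B) :|: (B :\: A))%SET &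
    forall q, q \in ((A :\: B) :|: (B :\: A))%SET -> c 0 q <= c 0 p.
  by have [p pAB pmax] := arg_maxP (fun i => c 0 i) p0AB; exists p.
wlog pA : A B mA mB neAB p0AB pAB pmax / p \in (A :\: B)%SET.
  move=> wlg; move: (pAB); rewrite inE => /orP[|] pD; first exact: (wlg A B).
  by apply: (wlg B A) => //; rewrite 1?eq_sym // finset.setUC.
have [q qB MA'] := bases_exchange mA.1 mB.1 pA.
move: (pA) (qB); rewrite !inE => /andP[pB pA1] /andP[qA qB1].
exists A, (q |: A :\ p)%SET, q, p; split=> //; first last.
- by rewrite evec_exchange // addrAC [X in X - _]addrC addKr.
- by apply: contraNneq qA => ->.
(* The entering [q] costs at most as much as the leaving [p], by the choice of [p]. *)
split=> // B' MB'; apply: le_trans (mA.2 _ MB').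
rewrite !dot_evec big_setU1 /=; last by rewrite !inE (negPf qA) andbF.
by rewrite (big_setD1 p pA1) /= lerD2r; apply: pmax; rewrite !inE qA qB1 orbT.
Qed.

Lemma minimal_in_face c B (F : set 'rV[R]_n) :
  F = [set x | P x /\ forall y, P y -> dot c x <= dot c y] ->
  minimal c B -> F (evec R B).
Proof.
move=> -> mB; split; first exact: base_in_polytope mB.1.
by move=> y; apply: minimal_dot.
Qed.

Lemma vertex_base v : vertex P v -> exists B, v = evec R B.
Proof.
case=> c Fc; have [B mB] := minimal_exists c.
by exists B; have /= -> := minimal_in_face Fc mB.
Qed.

(** If two bases minimize the cost of the edge, an exchange puts two points of difference
    [e_i - e_j] on its line. If only one does, the face is a single point, against [u != v]. *)
Lemma edge_direction u v : edge P u v -> exists i j : 'I_n, i != j /\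
  exists t : R, u - v = t *: (delta_mx 0 i - delta_mx 0 j).
Proof.
case=> neuv [c Fc]; have [B mB] := minimal_exists c.
have [[B' /andP[/asboolP mB' neB]]|uniqB] :=
    pselect (exists B', `[< minimal c B' >] && (B != B')).
  have [A [A' [i [j [mA mA' neij eA]]]]] := minimal_exchange mB mB' neB.
  exists i, j; split=> //.
  have [t et] := conv_hull2_line (minimal_in_face Fc mA).
  have [t' et'] := conv_hull2_line (minimal_in_face Fc mA').
  have eij : delta_mx 0 i - delta_mx 0 j = (t' - t) *: (u - v).
    by rewrite -eA et et' opprD addrACA subrr add0r -scalerBl.
  exists (t' - t)^-1; rewrite eij scalerA mulVf ?scale1r //.
  apply/eqP => tt; move: eij; rewrite tt scale0r => /rowP/(_ i)/eqP.
  by rewrite !mxE !eqxx (negPf neij) subr0 oner_eq0.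
suff uB x : conv_hull [set u; v] x -> x = evec R B.
  have eu : u = evec R B by apply: uB; apply: conv_hull_gen; left.
  have ev : v = evec R B by apply: uB; apply: conv_hull_gen; right.
  by rewrite eu ev eqxx in neuv.
rewrite Fc => -[Px xmin].
apply: (conv_hull_dot_unique _ Px) (xmin _ (base_in_polytope mB.1)).
move=> _ [B' MB' <-] neB; rewrite lt_neqAle mB.2 // andbT.
apply/eqP => eBB'; apply: uniqB; exists B'; apply/andP; split.
  by apply/asboolP; split=> // C MC; rewrite -eBB'; apply: mB.2.
by apply/eqP => eB; case: neB; rewrite eB.
Qed.

Lemma matroid_polytope_lgp : lattice_generalized_permutahedron P.
Proof.
split; last first.
  move=> v /vertex_base[B ->] i; rewrite evecE; exact: natr_int.
split; last exact: edge_direction.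
exists [seq evec R B | B <- enum (bases M)].
  rewrite -size_eq0 size_map -cardE -lt0n card_gt0; exact: bases_neq0.
congr conv_hull; apply/seteqP; split=> [_ [B MB <-]|x] /=.
  by apply/mapP; exists B; rewrite ?mem_enum.
by move=> /mapP[B]; rewrite mem_enum => MB ->; exists B.
Qed.

(** All bases have the same size, so meeting [S] least means meeting its complement most. *)
Lemma mu_matroid_polytope B S : B \in bases M ->
  mu P S = #|B|%:R - (rk (bases M) (~: S)%SET)%:R.
Proof.
move=> MB.
have cnt B' : \sum_(i in S) evec R B' 0 i = #|(B' :&: S)%SET|%:R.
  rewrite -dot_evecl dot_evec card_setI_sum natr_sum.
  by apply: eq_bigr => i _; rewrite evecE.
have cardS B' : B' \in bases M ->
    #|(B' :&: S)%SET|%:R = #|B|%:R - #|(B' :&: ~: S)%SET|%:R :> R.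
  move=> MB'; rewrite (card_bases (@bases_exchange _ M) MB MB') -(cardsID S B').
  by rewrite finset.setDE natrD addrK.
apply: minimum_eq.
  have [B' MB' ->] := rk_attained (bases_neq0 M) (~: S)%SET.
  by exists (evec R B'); [apply: base_in_polytope | rewrite cnt cardS].
move=> _ [x Px <-]; rewrite -dot_evecl; move: x Px; apply: conv_hull_dot_ge.
move=> _ [B' MB' <-]; rewrite dot_evecl cnt cardS // lerD2l lerN2 ler_nat.
exact: rk_max.
Qed.

Lemma MV_matroid_polytope : MV_polytope P <-> MV_rank (bases M) (@nat_of_ord n).
Proof.
have [B MB] : exists B, B \in bases M by apply/finset.set0Pn/bases_neq0.
pose r := rk (bases M); pose k : R := #|B|%:R.
(* Subtraction from [2 * k] exchanges minimum and maximum. *)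
have arith (p q s t w z : nat) :
    (k - p%:R + (k - q%:R) = Num.min (k - s%:R + (k - t%:R)) (k - w%:R + (k - z%:R)))
    <-> (p + q = maxn (s + t) (w + z))%N.
  have e (a b : nat) : k - a%:R + (k - b%:R) = 2 * k - (a + b)%:R by rewrite natrD; ring.
  have -> : Num.min (k - s%:R + (k - t%:R)) (k - w%:R + (k - z%:R)) =
      2 * k - (maxn (s + t) (w + z))%:R.
    rewrite !e; case: leqP => [le|/ltnW le]; [apply: min_r|apply: min_l];
    by rewrite lerD2l lerN2 ler_nat.
  rewrite e; split=> [/addrI/oppr_inj/eqP|->//].
  by rewrite eqr_nat => /eqP.
(* Disjointness is stated as a numerical bound so that the set identities below reduce to Boolean
   cases. *)
have disjE (S : {set 'I_n}) (a b c i : 'I_n) : a \notin S -> b \notin S -> c \notin S ->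
    (a < b < c)%N -> ((i == a) + (i == b) + (i == c) + (i \in S) <= 1)%N.
  move=> aS bS cS /andP[ab bc].
  have neab : a != b by apply: contraTneq ab => ->; rewrite ltnn.
  have nebc : b != c by apply: contraTneq bc => ->; rewrite ltnn.
  have neac : a != c by apply: contraTneq (ltn_trans ab bc) => ->; rewrite ltnn.
  case: (eqVneq i a) => [->|_]; first by rewrite (negPf neab) (negPf neac) (negPf aS).
  case: (eqVneq i b) => [->|_]; first by rewrite (negPf nebc) (negPf bS).
  by case: (eqVneq i c) => [->|_]; rewrite ?(negPf cS) //; case: (i \in S).
have muE S := mu_matroid_polytope S MB.
have MVE (S X : {set 'I_n}) (a b c : 'I_n) : X = (~: (S :|: [set a; b; c]))%SET ->
    a \notin S -> b \notin S -> c \notin S -> (a < b < c)%N ->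
    mu P (S :|: [set b])%SET + mu P (S :|: [set a; c])%SET =
    Num.min (mu P (S :|: [set a])%SET + mu P (S :|: [set b; c])%SET)
            (mu P (S :|: [set a; b])%SET + mu P (S :|: [set c])%SET) <->
    (r (b |: X)%SET + r (a |: (c |: X))%SET =
     maxn (r (a |: X)%SET + r (b |: (c |: X))%SET)
          (r (c |: X)%SET + r (a |: (b |: X))%SET))%N.
  move=> eX aS bS cS /andP[ab bc].
  have disj i := @disjE S a b c i aS bS cS (introT andP (conj ab bc)).
  have rE (S1 S2 : {set 'I_n}) : (forall i, (i \notin S1) = (i \in S2)) ->
      rk (bases M) (~: S1)%SET = r S2.
    by move=> e; congr r; apply/finset.setP => i; rewrite inE e.
  rewrite !muE.
  rewrite (rE (S :|: [set b])%SET (a |: (c |: X))%SET); last first.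
    by move=> i; have := disj i; rewrite eX !inE; do 3!case: (i == _); case: (i \in S).
  rewrite (rE (S :|: [set a; c])%SET (b |: X)%SET); last first.
    by move=> i; have := disj i; rewrite eX !inE; do 3!case: (i == _); case: (i \in S).
  rewrite (rE (S :|: [set a])%SET (b |: (c |: X))%SET); last first.
    by move=> i; have := disj i; rewrite eX !inE; do 3!case: (i == _); case: (i \in S).
  rewrite (rE (S :|: [set b; c])%SET (a |: X)%SET); last first.
    by move=> i; have := disj i; rewrite eX !inE; do 3!case: (i == _); case: (i \in S).
  rewrite (rE (S :|: [set a; b])%SET (c |: X)%SET); last first.
    by move=> i; have := disj i; rewrite eX !inE; do 3!case: (i == _); case: (i \in S).
  rewrite (rE (S :|: [set c])%SET (a |: (b |: X))%SET); last first.
    by move=> i; have := disj i; rewrite eX !inE; do 3!case: (i == _); case: (i \in S).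
  by rewrite arith (addnC (r (b |: X)%SET)) (addnC (r (a |: X)%SET)).
split=> [[_ MV] X a b c aX bX cX abc|MV].
  (* This choice of [S] is the inverse of the complementation in [MVE]. *)
  apply/(MVE (~: (X :|: [set a; b; c]))%SET) => //; first 1 last.
  - by rewrite !inE eqxx !orbT.
  - by rewrite !inE eqxx !orbT.
  - by rewrite !inE eqxx !orbT.
  - by apply: MV => //; rewrite !inE eqxx !orbT.
  apply/finset.setP => i; have := @disjE X a b c i aX bX cX abc; rewrite !inE.
  by do 3!case: (i == _); case: (i \in X).
split; first exact: matroid_polytope_lgp.
move=> S a b c aS bS cS abc; apply/(MVE _ _ _ _ _ erefl) => //.
by apply: MV => //; rewrite !inE eqxx !orbT.
Qed.

End MatroidPolytope.

Theorem theorem1 (R : realType) (n : nat) (M : matroid n) :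
  MV_polytope (matroid_polytope R M) <-> lattice_path_matroid M.
Proof.
rewrite MV_matroid_polytope lattice_path_parallel_convex.
exact: (MV_rankP (@bases_exchange _ M) (bases_neq0 M)).
Qed.
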